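(* Let $n\ge 1$ be an integer and let $x,y$ be complex numbers such that no denominator below vanishes, i.e. $x\notin\{-1,\dots,-n\}$, $x-y\notin\{-1,\dots,-n\}$ and $y\notin\{-n,-n+1,\dots,n-1\}$. Then $$\sum_{k=0}^n(-1)^k\binom{n}{k}\frac{\binom{y+k}{k}}{\binom{y-n+k}{k}}\frac{y}{y+k}H_{k}^{\langle4\rangle}(x)=\frac{(-1)^n}{6n}\,\frac{\binom{x-y+n}{n}}{\binom{x+n}{n}\binom{y}{n}}\Big\{\big[H_{n}(x-y)-H_{n}(x)\big]^3+2\big[H_{n}^{\langle3\rangle}(x-y)-H_{n}^{\langle3\rangle}(x)\big]$$ $$\qquad-3\big[H_{n}(x-y)-H_{n}(x)\big]\big[H_{n}^{\langle2\rangle}(x-y)-H_{n}^{\langle2\rangle}(x)\big]\Big\}.$$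
   Context: For a complex number $u$ and an integer $k\ge 0$, $\binom{u}{k}=\frac{u(u-1)\cdots(u-k+1)}{k!}$ (equal to $1$ for $k=0$). For a complex number $u$ and a positive integer $\ell$, the generalized harmonic numbers of $\ell$-order are $H_0^{\langle\ell\rangle}(u)=0$ and $H_n^{\langle\ell\rangle}(u)=\sum_{k=1}^n\frac{1}{(u+k)^\ell}$ for $n\ge1$; $H_n(u)=H_n^{\langle1\rangle}(u)$. *)

(* Defs.v *)
From HB Require Import structures.
From mathcomp Require Import all_boot all_order all_algebra.
From mathcomp Require Import reals complex.

Set Implicit Arguments.
Unset Strict Implicit.
Unset Printing Implicit Defensive.

Import Order.TTheory GRing.Theory Num.Theory.
Local Open Scope ring_scope.

Definition gbinom (F : fieldType) (u : F) (k : nat) : F :=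
  (\prod_(i < k) (u - i%:R)) / (k`!)%:R.

(* [gharm l n u] is H_n^{<l>}(u); 0 for n = 0 (empty sum). *)
Definition gharm (F : fieldType) (l n : nat) (u : F) : F :=
  \sum_(1 <= k < n.+1) 1 / (u + k%:R) ^+ l.

(* Main.v *)
(** With [V k = (-1)^k C(n-1, k) (y+k)(y+k-1)...(y+k-n+1)], the coefficient of
    [H_k^<4>(x)] is [V k - V (k-1)] up to the factor [1 / (y(y-1)...(y-n+1))], so summation
    by parts turns the left-hand side into a multiple of the sum over [k < n] of
    [V k / (x+1+k)^4].
    The [V k] are, up to a common factor, the residues at [t = -(x+1+k)] of the rational
    function [\prod_(i < n) (t + x - y + 1 + i) / (t + x + 1 + i)], so this sum is
    proportional to its Taylor coefficient of order [3] at [t = 0]; expanding the product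
    expresses that coefficient through power sums of the [1 / (x - y + 1 + i)] and
    [1 / (x + 1 + i)], which are the harmonic numbers. *)

Require Import Defs.
From mathcomp Require Import all_boot all_order all_algebra.
From mathcomp Require Import reals complex.
From mathcomp Require Import ring zify.

Set Implicit Arguments.
Unset Strict Implicit.
Unset Printing Implicit Defensive.

Import Order.TTheory GRing.Theory Num.Theory.
Local Open Scope ring_scope.
Local Open Scope complex_scope.

(** * Low-order coefficients of products of linear factors *)

Lemma coef_mul_XaddC (F : fieldType) (p : {poly F}) (c : F) (k : nat) :
  (p * ('X + c%:P))`_k = (if k is k'.+1 then p`_k' else 0) + p`_k * c.
Proof. by rewrite mulrDr coefD coefMC coefMX; case: k. Qed.

Definition inv_psum (F : fieldType) (n : nat) (a : nat -> F) (l : nat) : F :=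
  \sum_(i < n) (a i)^-1 ^+ l.

Lemma coef_prod_XaddC (F : numFieldType) (n : nat) (a : nat -> F) : (forall i, (i < n)%N -> a i != 0) ->
  let P := \prod_(i < n) ('X + (a i)%:P) in
  [/\ P`_0 = \prod_(i < n) a i,
      P`_1 = P`_0 * inv_psum n a 1,
      P`_2 = P`_0 * (inv_psum n a 1 ^+ 2 - inv_psum n a 2) / 2 &
      P`_3 = P`_0 * (inv_psum n a 1 ^+ 3 - 3 * inv_psum n a 1 * inv_psum n a 2
                     + 2 * inv_psum n a 3) / 6].
Proof.
elim: n => [|m IHm] a0 /=.
  by rewrite /inv_psum !big_ord0 !coef1 /=; split=> //; field.
have [|] := IHm; first by move=> i /ltnW; apply: a0.
rewrite /= /inv_psum !big_ord_recr /= !coef_mul_XaddC.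
set P := \prod_(i < m) _ => -> -> -> ->; have := a0 m (ltnSn m).
by move=> am; split; field.
Qed.

(** Dividing by the second product turns the hypothesis into P/Q = 1 + sum of [w m / ('X + b m)],
    whose coefficient of order 3 is minus the sum of [w m / b m ^+ 4]. On the other side, the
    logarithm of P/Q has the differences of power sums as coefficients, up to sign and index;
    exponentiating gives the cubic expression. *)
Lemma coef3_partial_fractions (F : numFieldType) (n : nat) (a b : nat -> F)
    (w : 'I_n -> F) :
    (forall i, (i < n)%N -> a i != 0) -> (forall i, (i < n)%N -> b i != 0) ->
    \prod_(i < n) ('X + (a i)%:P) = \prod_(i < n) ('X + (b i)%:P)
      + \sum_(m < n) w m *: \prod_(i < n | i != m) ('X + (b i)%:P) ->
  \sum_(m < n) w m * (b m)^-1 ^+ 4 =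
  - (\prod_(i < n) a i / \prod_(i < n) b i)
  * ((inv_psum n a 1 - inv_psum n b 1) ^+ 3 + 2 * (inv_psum n a 3 - inv_psum n b 3)
     - 3 * (inv_psum n a 1 - inv_psum n b 1) * (inv_psum n a 2 - inv_psum n b 2)) / 6.
Proof.
move=> a0 b0 PQ.
have [] := coef_prod_XaddC a0; have [] := coef_prod_XaddC b0.
have Q0 : \prod_(i < n) b i != 0 by apply/prodf_neq0 => i _; apply: b0.
move: PQ; set P := \prod_(i < n) _; set Q := \prod_(i < n) ('X + _).
move=> PQ Qc0 Qc1 Qc2 Qc3 Pc0 Pc1 Pc2 Pc3; rewrite -Pc0 -Qc0 in Q0 *.
pose Qm (m : 'I_n) : {poly F} := \prod_(i < n | i != m) ('X + (b i)%:P).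
have QmE m : Q = Qm m * ('X + (b m)%:P).
  by rewrite /Q /Qm (bigD1 m) //= mulrC.
pose S l : F := \sum_(m < n) w m * (b m)^-1 ^+ l.
have PE k : P`_k = Q`_k + \sum_(m < n) w m * (Qm m)`_k.
  by rewrite PQ coefD coef_sum; congr (_ + _); apply: eq_bigr => m _; rewrite coefZ.
have Qm0 m : (Qm m)`_0 = Q`_0 * (b m)^-1.
  by rewrite (QmE m) coef_mul_XaddC add0r mulfK ?b0.
(* Division of [Q] by ['X + b m], carried out from the constant term upwards. *)
have QmS m k : (Qm m)`_k.+1 = (Q`_k.+1 - (Qm m)`_k) * (b m)^-1.
  by rewrite (QmE m) coef_mul_XaddC [_ + _ * _]addrC addrK mulfK ?b0.
(* [E0] to [E3] compare coefficients in P = Q (1 + S 1 - S 2 X + S 3 X^2 - S 4 X^3 + ...), without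
   power series. *)
have E0 : P`_0 = Q`_0 * (1 + S 1%N).
  rewrite PE mulrDr mulr1 mulr_sumr; congr (_ + _).
  by apply: eq_bigr => m _; rewrite Qm0; ring.
have E1 : P`_1 = Q`_1 * (1 + S 1%N) - Q`_0 * S 2%N.
  rewrite PE mulrDr mulr1 -addrA; congr (_ + _).
  rewrite !mulr_sumr -sumrB; apply: eq_bigr => m _; rewrite QmS Qm0; ring.
have E2 : P`_2 = Q`_2 * (1 + S 1%N) - Q`_1 * S 2%N + Q`_0 * S 3%N.
  rewrite PE mulrDr mulr1 -!addrA; congr (_ + _).
  rewrite !mulr_sumr -sumrN -!big_split; apply: eq_bigr => m _ /=.
  rewrite !QmS Qm0; ring.
have E3 : P`_3 = Q`_3 * (1 + S 1%N) - Q`_2 * S 2%N + Q`_1 * S 3%N - Q`_0 * S 4%N.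
  rewrite PE mulrDr mulr1 -!addrA; congr (_ + _).
  rewrite !mulr_sumr -!sumrN -!big_split; apply: eq_bigr => m _ /=.
  rewrite !QmS Qm0; ring.
have {}E0 : 1 + S 1%N = P`_0 / Q`_0 by rewrite E0 mulrC mulKf.
have {}E1 : S 2%N = (Q`_1 * (1 + S 1%N) - P`_1) / Q`_0 by rewrite E1; field.
have {}E2 : S 3%N = (P`_2 - Q`_2 * (1 + S 1%N) + Q`_1 * S 2%N) / Q`_0.
  by rewrite E2; field.
have -> : \sum_(m < n) w m * (b m)^-1 ^+ 4 =
    (Q`_3 * (1 + S 1%N) - Q`_2 * S 2%N + Q`_1 * S 3%N - P`_3) / Q`_0.
  by rewrite E3 /S; field.
by rewrite E2 E1 E0 Pc3 Pc2 Pc1 Qc3 Qc2 Qc1; field.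
Qed.

(** * Falling factorials, and sums and products reindexed from 0 *)

Definition ffactr (F : fieldType) (u : F) (n : nat) : F := \prod_(i < n) (u - i%:R).

(** Both sides are the falling factorial of [u + 1] of length [n + 1], with its last or its first
    factor split off. *)
Lemma ffactr_shift (F : fieldType) (u : F) (n : nat) :
  ffactr (u + 1) n * (u - n%:R + 1) = ffactr u n * (u + 1).
Proof.
elim: n => [|n IHn]; first by rewrite /ffactr !big_ord0 !mul1r subr0.
rewrite /ffactr !big_ord_recr /= -!/(ffactr _ _) mulrAC.
rewrite [RHS]mulrAC -IHn -natr1; ring.
Qed.

Lemma prodr_add_rev (F : fieldType) (u : F) (n : nat) :
  \prod_(i < n) (u + n%:R - i%:R) = \prod_(i < n) (u + 1 + i%:R).
Proof.
rewrite (reindex_inj rev_ord_inj); apply: eq_bigr => i _ /=.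
rewrite natrB ?ltn_ord // -natr1; ring.
Qed.

Lemma gbinomDnE (F : fieldType) (u : F) (n : nat) :
  gbinom (u + n%:R) n = (\prod_(i < n) (u + 1 + i%:R)) / n`!%:R.
Proof. by rewrite /gbinom prodr_add_rev. Qed.

Lemma gharmE (F : fieldType) (l n : nat) (u : F) :
  gharm l n u = \sum_(i < n) (u + 1 + i%:R)^-1 ^+ l.
Proof.
rewrite /gharm big_add1 big_mkord; apply: eq_bigr => i _.
by rewrite div1r exprVn -natr1 addrAC addrA.
Qed.

(** * Partial fractions by Lagrange interpolation *)

Lemma prod_lagrange_nodes (F : fieldType) (n : nat) (m : 'I_n.+1) :
  \prod_(i < n.+1 | i != m) (i%:R - m%:R : F) = (-1) ^+ m * (m`! * (n - m)`!)%:R.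
Proof.
have lt_mn := ltn_ord m.
rewrite -(big_mkord (fun i => i != m :> nat) (fun i => i%:R - m%:R)).
rewrite (@big_cat_nat _ _ _ m) ?(ltnW lt_mn) //= (@big_ltn_cond _ _ _ m) ?lt_mn //= eqxx /=.
(* The factors with [i < m] are negative and give (-1)^m m!; those with [i > m] give (n - m)!. *)
rewrite natrM mulrA; congr (_ * _).
  rewrite big_nat_cond (eq_bigl (fun i => (0 <= i < m)%N)); last first.
    by move=> i; case: ltngtP.
  rewrite -big_nat big_mkord (reindex_inj rev_ord_inj) fact_prod big_add1 big_mkord.
  rewrite natr_prod -[X in _ ^+ X]card_ord -prodrN.
  by apply: eq_bigr => i _ /=; rewrite natrB ?ltn_ord // addrAC subrr sub0r.
rewrite big_nat_cond (eq_bigl (fun i => (m < i < n.+1)%N)); last first.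
  by move=> i; case: (ltngtP m i); rewrite ?andbF ?andbT.
rewrite -big_nat -[m.+1]add0n big_addn subSS big_mkord.
rewrite fact_prod big_add1 big_mkord natr_prod.
by apply: eq_bigr => i _; rewrite addnS -addSn natrD addrK.
Qed.

(** Both full products are monic of degree [n + 1], so the two sides differ by a polynomial of
    degree at most [n], which is zero once it vanishes at the [n + 1] distinct points [- (u + j)].
    At such a point only the term [m = j] survives, and this determines its weight. *)
Lemma prod_partial_fractions (F : numFieldType) (n : nat) (u y : F) :
  \prod_(i < n.+1) ('X + (u - y + i%:R)%:P) =
  \prod_(i < n.+1) ('X + (u + i%:R)%:P)
  + \sum_(m < n.+1) ((-1) ^+ n.+1 / n`!%:R *
                      ((-1) ^+ m * 'C(n, m)%:R * ffactr (y + m%:R) n.+1))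
      *: \prod_(i < n.+1 | i != m) ('X + (u + i%:R)%:P).
Proof.
pose P (a : nat -> F) (A : pred 'I_n.+1) := \prod_(i < n.+1 | A i) ('X + (a i)%:P).
have PE a A : P a A = \prod_(c <- [seq - a (val i) | i <- enum A]) ('X - c%:P).
  by rewrite big_map big_enum; apply: eq_bigr => i _; rewrite polyCN opprK.
have sizeP a A : size (P a A) = #|A|.+1.
  by rewrite PE size_prod_XsubC size_map cardE.
have leadP a : (P a xpredT)`_n.+1 = 1.
  have /monicP := monic_prod_XsubC [seq - a (val i) | i <- enum 'I_n.+1] xpredT id.
  by rewrite -PE lead_coefE sizeP card_ord.
apply/eqP; rewrite -subr_eq0 opprD addrA; apply/eqP.
apply: (@roots_geq_poly_eq0 _ _ [seq - (u + j%:R) | j <- iota 0 n.+1]).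
- apply/allP => c /mapP [j]; rewrite mem_iota add0n => /= lt_jn ->{c}.
  pose jn := Ordinal lt_jn.
  have XaddCE (c z : F) : ('X + c%:P).[z] = z + c by rewrite hornerD hornerX hornerC.
  rewrite rootE !(hornerD, hornerN, horner_prod, horner_sum) /=.
  rewrite [X in _ - X - _](bigD1 jn) //= XaddCE addNr mul0r subr0.
  rewrite [X in _ - X](bigD1 jn) //= [X in _ - (_ + X)]big1 ?addr0 => [|m ne_mj]; last first.
    rewrite hornerZ horner_prod (bigD1 jn) 1?eq_sym //= XaddCE addNr.
    by rewrite mul0r mulr0.
  rewrite hornerZ horner_prod.
  rewrite [X in _ * X](eq_bigr (fun i : 'I_n.+1 => i%:R - j%:R)); last first.
    by move=> i _; rewrite XaddCE; ring.
  rewrite (prod_lagrange_nodes _ jn) /=.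
  (* At [- (u + j)] the left-hand product becomes, up to the sign (-1)^(n+1), the falling factorial
     of [y + j]. *)
  rewrite (eq_bigr (fun i : 'I_n.+1 => - (y + j%:R - i%:R))); last first.
    by move=> i _; rewrite XaddCE; ring.
  rewrite prodrN card_ord -/(ffactr _ _) subr_eq0; apply/eqP.
  have fact0 : n`!%:R != 0 :> F by rewrite pnatr_eq0 -lt0n fact_gt0.
  have sgnK : (-1) ^+ j * (-1) ^+ j = 1 :> F by rewrite -expr2 sqrr_sign.
  have := @bin_fact n j lt_jn => /(congr1 (fun k => k%:R : F)); rewrite natrM => binE.
  set B := ffactr _ _; set C := _%:R in binE *; set D := _%:R in binE *.
  transitivity ((-1) ^+ n.+1 / n`!%:R * B * ((-1) ^+ j * (-1) ^+ j) * (C * D)).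
    by rewrite sgnK binE; field.
  ring.
- rewrite map_inj_uniq ?iota_uniq // => i j /oppr_inj /addrI /eqP.
  by rewrite eqr_nat => /eqP.
rewrite size_map size_iota (leq_trans (size_polyD _ _)) // geq_max size_polyN.
apply/andP; split; last first.
  apply: (leq_trans (size_sum _ _ _)); apply/bigmax_leqP => m _.
  rewrite (leq_trans (size_scale_leq _ _)) //.
  by rewrite (sizeP (fun i => u + i%:R) [pred i | i != m]) cardC1 card_ord.
apply/leq_sizeP => j; rewrite leq_eqVlt coefB => /predU1P[<- | lt_nj].
  by rewrite (leadP (fun i => u - y + i%:R)) (leadP (fun i => u + i%:R)) subrr.
have coef0 a : (P a xpredT)`_j = 0 by rewrite nth_default // sizeP card_ord.
by rewrite (coef0 (fun i => u - y + i%:R)) (coef0 (fun i => u + i%:R)) subrr.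
Qed.

(** * Summation by parts and assembly of the identity *)

Lemma gbinom_ratio (F : numFieldType) (n k : nat) (y : F) :
    (forall i, (i < n.+1)%N -> y - i%:R != 0) -> (k <= n.+1)%N ->
  gbinom (y + k%:R) k / gbinom (y - n.+1%:R + k%:R) k
  = ffactr (y + k%:R) n.+1 / ffactr y n.+1.
Proof.
move=> y0 le_kn; rewrite !gbinomDnE.
have fact0 : k`!%:R != 0 :> F by rewrite pnatr_eq0 -lt0n fact_gt0.
have ff0 : ffactr y n.+1 != 0 by apply/prodf_neq0 => i _; apply: y0.
have den0 : \prod_(i < k) (y - n.+1%:R + 1 + i%:R) != 0.
  apply/prodf_neq0 => i _; have lt_in : (i <= n)%N.
    by rewrite -ltnS (leq_trans (ltn_ord i)).
  have := y0 (n - i)%N; rewrite ltnS leq_subr natrB // => /(_ isT).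
  by congr (_ != 0); rewrite -natr1; ring.
(* Both sides are the product of all factors from [y + k] down to [y - n], cut at different
   places. *)
have E : ffactr (y + k%:R) n.+1 * \prod_(i < k) (y - n.+1%:R + 1 + i%:R)
    = ffactr y n.+1 * \prod_(i < k) (y + 1 + i%:R).
  elim: k {le_kn fact0 den0} => [|k IHk]; first by rewrite !big_ord0 addr0.
  rewrite !big_ord_recr /= -natr1 [RHS]mulrA -IHk.
  have := ffactr_shift (y + k%:R) n.+1; rewrite addrA.
  set A := ffactr _ _; set B := ffactr _ _; set C := \prod_(_ < _) _ => AB.
  transitivity (C * (A * (y + k%:R - n.+1%:R + 1))); first by ring.
  by rewrite AB; ring.
apply/eqP; rewrite eqr_div // ?mulf_neq0 ?invr_eq0 //; apply/eqP.
by rewrite mulrA E; ring.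
Qed.

(** Abel summation, with the upper limit [p] left free for the induction; at [p = n + 1] the
    boundary term vanishes because 'C(n, n+1) = 0. *)
Lemma sum_by_parts (F : numFieldType) (n : nat) (y : F) (h : nat -> F) (p : nat) :
    (forall k, (k <= n.+1)%N -> y + k%:R != 0) -> (p <= n.+1)%N ->
  let V k := (-1) ^+ k * 'C(n, k)%:R * ffactr (y + k%:R) n.+1 in
  \sum_(k < p.+1) (-1) ^+ k * 'C(n.+1, k)%:R * ffactr (y + k%:R) n.+1
     * (y / (y + k%:R)) * \sum_(i < k) h i
  = V p * \sum_(i < p) h i - \sum_(i < p) V i * h i.
Proof.
move=> y0 + V; elim: p => [_|p IHp le_pn].
  by rewrite big_ord1 /= !big_ord0 !mulr0 subr0.
rewrite big_ord_recr /= (IHp (ltnW le_pn)) !big_ord_recr /=.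
have -> : (-1) ^+ p.+1 * 'C(n.+1, p.+1)%:R * ffactr (y + p.+1%:R) n.+1
    * (y / (y + p.+1%:R)) = V p.+1 - V p; last by ring.
have := ffactr_shift (y + p%:R) n.+1.
rewrite -addrA !natr1 -[n.+1%:R]natr1 /V binS natrD exprS.
have := mul_bin_left n p => /(congr1 (fun k => k%:R : F)).
rewrite !natrM natrB // -natr1.
have := y0 _ le_pn; rewrite -[p.+1%:R]natr1.
set A := ffactr _ _; set B := ffactr _ _.
set C := 'C(n, p.+1)%:R; set D := 'C(n, p)%:R; set s := _ ^+ p => yp CD AB.
(* Solving for [B], the falling factorial of [y + p], divides only by [y + p + 1], nonzero by [y0];
   the factor [y + p - n] could vanish. *)
have -> : B = A * (y + p%:R - n%:R) / (y + (p%:R + 1)).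
  by apply/(canRL (mulfK yp)); rewrite -AB; ring.
have -> : C = (n%:R - p%:R) * D / (p%:R + 1).
  by rewrite -CD; field; rewrite natr1 pnatr_eq0.
by field; rewrite yp natr1 pnatr_eq0.
Qed.

Lemma harmonic4_sum (F : numFieldType) (n : nat) (x y : F) :
    (forall i, (i < n.+1)%N -> x + 1 + i%:R != 0) ->
    (forall i, (i < n.+1)%N -> x - y + 1 + i%:R != 0) ->
    (forall k, (k <= n.+1)%N -> y + k%:R != 0) ->
    (forall i, (i < n.+1)%N -> y - i%:R != 0) ->
  \sum_(0 <= k < n.+2)
     (-1) ^+ k * 'C(n.+1, k)%:R
     * (gbinom (y + k%:R) k / gbinom (y - n.+1%:R + k%:R) k)
     * (y / (y + k%:R)) * gharm 4 k x
  = (-1) ^+ n.+1 / (6 * n.+1%:R)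
    * (gbinom (x - y + n.+1%:R) n.+1 / (gbinom (x + n.+1%:R) n.+1 * gbinom y n.+1))
    * ((gharm 1 n.+1 (x - y) - gharm 1 n.+1 x) ^+ 3
       + 2 * (gharm 3 n.+1 (x - y) - gharm 3 n.+1 x)
       - 3 * (gharm 1 n.+1 (x - y) - gharm 1 n.+1 x)
           * (gharm 2 n.+1 (x - y) - gharm 2 n.+1 x)).
Proof.
move=> x0 xy0 yD0 yB0; pose h i : F := (x + 1 + i%:R)^-1 ^+ 4.
pose V k : F := (-1) ^+ k * 'C(n, k)%:R * ffactr (y + k%:R) n.+1.
have ff0 : ffactr y n.+1 != 0 by apply/prodf_neq0 => i _; apply: yB0.
have fact0 : n`!%:R != 0 :> F by rewrite pnatr_eq0 -lt0n fact_gt0.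
have n0 : n.+1%:R != 0 :> F by rewrite pnatr_eq0.
transitivity (- (ffactr y n.+1)^-1 * \sum_(i < n.+1) V i * h i).
  have := sum_by_parts h yD0 (leqnn _).
  rewrite /= bin_small // mulr0 !mul0r sub0r mulNr -mulrN -/V => <-.
  rewrite mulr_sumr big_mkord; apply: eq_bigr => k _.
  by rewrite gbinom_ratio -1?ltnS // gharmE /h; ring.
(* With [u = x + 1], the weights are [V i] times the constant (-1)^(n+1) / n!, and the power sums
   are the harmonic numbers at [x - y] and [x]. *)
have := @coef3_partial_fractions F n.+1 (fun i => x + 1 - y + i%:R)
  (fun i => x + 1 + i%:R) _ _ _ (prod_partial_fractions n (x + 1) y).
have -> : x + 1 - y = x - y + 1 by rewrite addrAC.
move=> /(_ xy0 x0) /=; rewrite /inv_psum -!gharmE.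
rewrite [X in X = _ -> _](_ : _ = (-1) ^+ n.+1 / n`!%:R * \sum_(i < n.+1) V i * h i);
  last by rewrite mulr_sumr; apply: eq_bigr => i _; exact/esym/mulrA.
have sgn0 : (-1) ^+ n.+1 / n`!%:R != 0 :> F by rewrite mulf_neq0 ?signr_eq0 ?invr_eq0.
move/(canRL (mulKf sgn0)) => ->; rewrite invf_div invr_sign.
(* The n! from the weights against the (n+1)! in [gbinom y n.+1] leaves the factor 1/(n+1). *)
rewrite !gbinomDnE /gbinom -/(ffactr _ _) factS natrM.
have xE : \prod_(i < n.+1) (x + 1 + i%:R) != 0.
  by apply/prodf_neq0 => i _; apply: x0.
by field; rewrite fact0 ff0 xE nat1r n0.
Qed.

Theorem theorem12 (R : realType) (n : nat) (x y : R[i])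
  (hn : (1 <= n)%N)
  (hx : forall j : nat, (1 <= j <= n)%N -> x <> - j%:R)
  (hxy : forall j : nat, (1 <= j <= n)%N -> x - y <> - j%:R)
  (hy : forall j : int, - n%:Z <= j <= n%:Z - 1 -> y <> j%:~R) :
  \sum_(0 <= k < n.+1)
     (-1) ^+ k * 'C(n, k)%:R * (gbinom (y + k%:R) k / gbinom (y - n%:R + k%:R) k)
     * (y / (y + k%:R)) * gharm 4 k x
  = (-1) ^+ n / (6 * n%:R)
    * (gbinom (x - y + n%:R) n / (gbinom (x + n%:R) n * gbinom y n))
    * ((gharm 1 n (x - y) - gharm 1 n x) ^+ 3
       + 2 * (gharm 3 n (x - y) - gharm 3 n x)
       - 3 * (gharm 1 n (x - y) - gharm 1 n x)
           * (gharm 2 n (x - y) - gharm 2 n x)).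
Proof.
case: n hn hx hxy hy => // n _ hx hxy hy.
have nonzero (z : R[i]) : (forall j : nat, (1 <= j <= n.+1)%N -> z <> - j%:R) ->
    forall i, (i < n.+1)%N -> z + 1 + i%:R != 0.
  move=> hz i lt_in; apply/eqP => /eqP; rewrite -addrA nat1r addr_eq0 => /eqP.
  exact: hz.
(* The integers excluded for [y] split into those at most 0, for [y + k], and those at least 0, for
   [y - i]. *)
apply: harmonic4_sum; [exact: nonzero | exact: nonzero | |].
- move=> k le_kn; apply/eqP => /eqP; rewrite addr_eq0 => /eqP yE.
  by apply: (hy (- k%:Z)); [lia | rewrite yE mulrNz].
- move=> i lt_in; apply/eqP => /eqP; rewrite subr_eq0 => /eqP.
  by apply: (hy i%:Z); lia.
Qed.
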